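(* Let $0<p\le 1$, let $K\subseteq\mathbb{R}^n$ be a $p$-convex set, and let $F=(f_1,\ldots,f_m):K\to\mathbb{R}^m_+$ be an $\mathbb{R}^m_+$-$p$-convex mapping. Then, for every $\bar x\in E_W(K)$ and for all $\lambda,\mu\ge 0$ satisfying $\lambda^p+\mu^p=1$, the point $(\lambda+\mu)\bar x$ also belongs to $E_W(K)$.
   Context: For $0<p\le 1$, a set $K\subseteq\mathbb{R}^n$ is called $p$-convex if $\lambda x+\mu y\in K$ for every $x,y\in K$ and all $\lambda,\mu\ge 0$ with $\lambda^p+\mu^p=1$. $\mathbb{R}^m_+$ is the set of vectors in $\mathbb{R}^m$ with nonnegative coordinates ($m\ge 1$). For a $p$-convex set $K$, a mapping $F:K\to\mathbb{R}^m$ is $\mathbb{R}^m_+$-$p$-convex if $\lambda F(x)+\mu F(y)\in F(\lambda x+\mu y)+\mathbb{R}^m_+$ for all $x,y\in K$ and all $\lambda,\mu\ge 0$ with $\lambda^p+\mu^p=1$. A point $\bar x\in K$ is a weakly efficient point of $F$ on $K$ if $F(x)-F(\bar x)\in\mathbb{R}^m\setminus(-\mathrm{int}\,\mathbb{R}^m_+)$ for all $x\in K$, i.e. there is no $x\in K$ with $f_i(x)<f_i(\bar x)$ for all $i$. $E_W(K)$ denotes the set of weakly efficient points of $F$ on $K$. *)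

(* Defs.v *)
From HB Require Import structures.
From mathcomp Require Import all_boot all_order all_algebra.
From mathcomp Require Import all_classical all_reals all_analysis.

Set Implicit Arguments.
Unset Strict Implicit.
Unset Printing Implicit Defensive.

Import Order.TTheory GRing.Theory Num.Theory.
Import numFieldNormedType.Exports.

Local Open Scope classical_set_scope.
Local Open Scope ring_scope.

(* For [0 < p], [powR] satisfies [0 `^ p = 0], so the endpoints
   (l, mu) = (1, 0) and (0, 1) are admissible weights. *)
Definition pweights (R : realType) (p l mu : R) : Prop :=
  [/\ 0 <= l, 0 <= mu & l `^ p + mu `^ p = 1].

Definition pconvex_set (R : realType) (n : nat) (p : R) (K : set 'rV[R]_n) :
    Prop :=
  forall (x y : 'rV[R]_n) (l mu : R),
    K x -> K y -> pweights p l mu -> K (l *: x + mu *: y).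

Definition orthant (R : realType) (m : nat) : set 'rV[R]_m :=
  [set v | forall i, 0 <= v ord0 i].

Arguments orthant : clear implicits.

(* A mapping on [K] is represented by a total function; only its values on [K]
   matter when [K] is p-convex. *)
Definition pconvex_map (R : realType) (n m : nat) (p : R) (K : set 'rV[R]_n)
    (F : 'rV[R]_n -> 'rV[R]_m) : Prop :=
  forall (x y : 'rV[R]_n) (l mu : R),
    K x -> K y -> pweights p l mu ->
    [set F (l *: x + mu *: y) + c | c in orthant R m] (l *: F x + mu *: F y).

Definition weakly_efficient (R : realType) (n m : nat)
    (F : 'rV[R]_n -> 'rV[R]_m) (K : set 'rV[R]_n) : set 'rV[R]_n :=
  [set xbar | K xbar /\
    forall x, K x ->
      (~` [set - v | v in (orthant R m)^°]) (F x - F xbar)].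

(* Main.v *)
Require Import Defs.
From HB Require Import structures.
From mathcomp Require Import all_boot all_order all_algebra.
From mathcomp Require Import all_classical all_reals all_analysis.

Set Implicit Arguments.
Unset Strict Implicit.
Unset Printing Implicit Defensive.

Import Order.TTheory GRing.Theory Num.Theory.
Import numFieldNormedType.Exports.

Local Open Scope classical_set_scope.
Local Open Scope ring_scope.

(** Setting y = (l + mu) x, p-convexity with both points equal to x gives
    F y <= (l + mu) F x coordinatewise.  Since 0 < p <= 1, every admissible
    weight satisfies t <= t^p, so l + mu <= 1; as F x >= 0 this yields
    F y <= F x.  A point whose image lies weakly below that of a weakly
    efficient point is weakly efficient. *)

(** Translation by [- c] is continuous and sends [v + c] to [v], so for [w] near [v + c] the vector
    [w - c] is in the orthant, and adding [c] back keeps it there. *)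
Lemma interior_orthantD (R : realType) (m : nat) (v c : 'rV[R]_m) :
  (orthant R m)^° v -> orthant R m c -> (orthant R m)^° (v + c).
Proof.
move=> v_int c_ge0.
have shift_cvg : (fun w : 'rV[R]_m => w - c) @ (v + c) --> v.
  rewrite -[X in _ --> X](addrK c v).
  exact: (@cvgB _ _ _ (nbhs (v + c)) _ id (cst c) _ _ cvg_id (cvg_cst c)).
apply: (@filterS _ (nbhs (v + c)) _ _ _ _ (shift_cvg _ v_int)) => w /= wc_ge0 i.
by rewrite -[w](subrK c) mxE addr_ge0.
Qed.

Lemma weakly_efficient_le (R : realType) (n m : nat) (F : 'rV[R]_n -> 'rV[R]_m)
    (K : set 'rV[R]_n) (x y : 'rV[R]_n) :
  weakly_efficient F K x -> K y -> (forall i, F y ord0 i <= F x ord0 i) ->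
  weakly_efficient F K y.
Proof.
move=> [_ x_eff] Ky Fyx; split=> // z Kz [v v_int vE]; apply: (x_eff z Kz).
(* If [z] strictly improved on [y] by [v], it would improve on [x] by [v] plus the nonnegative gap
   [F x - F y], still an interior vector. *)
exists (v + (F x - F y)).
  by apply: interior_orthantD => // i; rewrite !mxE subr_ge0.
by rewrite opprD vE opprB addrA subrK.
Qed.

Lemma pweights_sum_le1 (R : realType) (p l mu : R) :
  0 < p -> p <= 1 -> pweights p l mu -> l + mu <= 1.
Proof.
move=> p_gt0 p_le1 [l_ge0 mu_ge0 lmu1].
have le_powR (a b : R) : 0 <= a -> a `^ p + b `^ p = 1 -> a <= a `^ p.
  move=> a_ge0 ab1.
  have [->|a_neq0] := eqVneq a 0; first exact: powR_ge0.
  have a_gt0 : 0 < a by rewrite lt_def a_neq0.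
  have a_le1 : a <= 1.
    (* If [a > 1], then [a]^ p > 1[, which exceeds the total since]b [^ p] is nonnegative. *)
    rewrite leNgt; apply/negP => a_gt1.
    have : 1 `^ p < a `^ p by apply: gt0_ltr_powR => //; rewrite nnegrE.
    by rewrite powR1 -ab1 ltNge lerDl powR_ge0.
  (* For a base in [(0, 1]] the power decreases in the exponent; compare exponents [1] and [p]. *)
  by rewrite -[X in X <= _]powRr1 //; apply: ger_powR => //; rewrite a_gt0.
rewrite -lmu1; apply: lerD; first exact: le_powR lmu1.
by apply: (le_powR _ l) => //; rewrite addrC.
Qed.

Theorem theorem6p5 (R : realType) (n m : nat) (p : R) (K : set 'rV[R]_n)
    (F : 'rV[R]_n -> 'rV[R]_m)
    (m_gt0 : (0 < m)%N) (p_gt0 : 0 < p) (p_le1 : p <= 1)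
    (K_pconvex : pconvex_set p K)
    (F_orthant : set_fun K (orthant R m) F)
    (F_pconvex : pconvex_map p K F) :
  forall xbar : 'rV[R]_n, weakly_efficient F K xbar ->
  forall l mu : R, 0 <= l -> 0 <= mu -> l `^ p + mu `^ p = 1 ->
    weakly_efficient F K ((l + mu) *: xbar).
Proof.
move=> x x_eff l mu l_ge0 mu_ge0 lmu1.
have Kx : K x := x_eff.1.
have w : pweights p l mu by split.
apply: (weakly_efficient_le x_eff) => [|i].
  by rewrite scalerDl; exact: K_pconvex.
rewrite scalerDl.
have [c c_ge0 cE] := F_pconvex _ _ _ _ Kx Kx w.
apply: (@le_trans _ _ ((l + mu) * F x ord0 i)).
  (* The slack [c] is the nonnegative difference of the two sides. *)
  have /matrixP/(_ ord0 i) := cE.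
  by rewrite !mxE -mulrDl => <-; rewrite lerDl.
apply: ler_piMl; first exact: F_orthant.
exact: pweights_sum_le1 w.
Qed.
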